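(* Let $G=(V,E)$ be a finite simple graph of order $n\ge 1$ with maximum degree $\delta_1$ and minimum degree $\delta_n$. For all $k,r\in\mathbb{Z}$ such that $-\delta_n\le k\le\delta_1$, $0\le r\le\frac{k+\delta_n}{2}$, and $G$ contains a defensive $k$-alliance, $$a_{k-2r}(G)+r\le a_k(G).$$
   Context: For a set $X\subseteq V$ and $v\in V$, $\delta_X(v)$ denotes the number of neighbors of $v$ in $X$, and $\bar S=V\setminus S$. For an integer $k$, a nonempty set $S\subseteq V$ is a defensive $k$-alliance in $G$ if $\delta_S(v)\ge \delta_{\bar S}(v)+k$ for every $v\in S$. The defensive $k$-alliance number $a_k(G)$ is the minimum cardinality of a defensive $k$-alliance in $G$. (For $k\le\delta_n$ a defensive $k$-alliance always exists, e.g. $S=V$.) *)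

(* Defs.v *)
(* A finite simple graph on the vertex type V is a symmetric
   irreflexive relation e : rel V. The definitions below take any e : rel V;
   the two properties are assumed where needed. *)
From mathcomp Require Export all_boot all_order all_algebra.

Set Implicit Arguments.
Unset Strict Implicit.
Unset Printing Implicit Defensive.

Import Order.TTheory GRing.Theory Num.Theory.
Local Open Scope ring_scope.

Definition deg_in (V : finType) (e : rel V) (X : {set V}) (v : V) : nat :=
  #|[set u in X | e v u]|.

Definition degree (V : finType) (e : rel V) (v : V) : nat :=
  deg_in e [set: V] v.

Definition max_degree (V : finType) (e : rel V) : nat :=
  (\max_(v : V) degree e v)%N.

(* Every degree is at most #|V|, so the starting value #|V| does not affect
   the minimum as soon as V is nonempty. *)
Definition min_degree (V : finType) (e : rel V) : nat :=
  \big[minn/#|V|]_(v : V) degree e v.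

Definition defensive_alliance (V : finType) (e : rel V) (k : int)
    (S : {set V}) : bool :=
  (S != set0) &&
  [forall v in S, (deg_in e S v)%:Z >= (deg_in e (~: S) v)%:Z + k].

(* The starting value #|V| bounds every #|S|, so this is the true minimum
   whenever a defensive k-alliance exists (alliance_number_attained and
   alliance_number_le); it is the junk value #|V| when there is none. *)
Definition alliance_number (V : finType) (e : rel V) (k : int) : nat :=
  \big[minn/#|V|]_(S : {set V} | defensive_alliance e k S) #|S|.

Lemma bigminn_le (I : finType) (P : pred I) (F : I -> nat) (m : nat) (i : I) :
  P i -> (\big[minn/m]_(j | P j) F j <= F i)%N.
Proof.
move=> Pi; have : i \in index_enum I by rewrite mem_index_enum.
elim: (index_enum I) => [//|j s IHs]; rewrite inE big_cons.
case/orP=> [/eqP<-|/IHs les]; first by rewrite Pi geq_minl.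
by case: ifP => // _; rewrite (leq_trans (geq_minr _ _)).
Qed.

Lemma alliance_number_le (V : finType) (e : rel V) (k : int) (S : {set V}) :
  defensive_alliance e k S -> (alliance_number e k <= #|S|)%N.
Proof. exact: bigminn_le. Qed.

Lemma alliance_number_attained (V : finType) (e : rel V) (k : int) :
  (exists S, defensive_alliance e k S) ->
  exists2 S, defensive_alliance e k S & #|S| = alliance_number e k.
Proof.
case=> S0 aS0; have [S aS minS] := @arg_minnP _ S0 _ (fun S => #|S|) aS0.
exists S => //; apply/eqP; rewrite eqn_leq alliance_number_le // andbT.
rewrite /alliance_number; elim/big_ind: _ => [|m n lem len|T aT].
- exact: max_card.
- by rewrite leq_min lem len.
- exact: minS.
Qed.

Lemma min_degree_le (V : finType) (e : rel V) (v : V) :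
  (min_degree e <= degree e v)%N.
Proof. exact: bigminn_le. Qed.

Lemma min_degree_attained (V : finType) (e : rel V) :
  (0 < #|V|)%N -> exists v, degree e v = min_degree e.
Proof.
case/card_gt0P=> v0 _.
have [v _ minv] := @arg_minnP _ v0 xpredT (degree e) isT.
exists v; apply/eqP; rewrite eqn_leq min_degree_le andbT.
rewrite /min_degree; elim/big_ind: _ => [|m n lem len|u _].
- exact: max_card.
- by rewrite leq_min lem len.
- exact: minv.
Qed.

(* Main.v *)
Require Import Defs.
From mathcomp Require Import all_boot all_order all_algebra.
From mathcomp Require Import zify lra.
Import Order.TTheory GRing.Theory Num.Theory.
Local Open Scope ring_scope.

(** Deleting one vertex [u] from a defensive alliance [S] moves [u] from inside
    to outside, so for each remaining vertex the difference between its inside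
    and outside degrees drops by at most 2.  Deleting [r] vertices of a
    [k]-alliance therefore leaves a [(k - 2r)]-alliance as soon as something is
    left ([defensive_allianceD]).  Something is left because a vertex [v] of [S]
    has at least [(deg v + k) / 2 >= r] neighbours in [S], all different from
    [v], so that [S] has more than [r] vertices ([min_degree_alliance_lt]).
    Applied to a smallest [k]-alliance this gives the inequality. *)

Lemma deg_inID (V : finType) (e : rel V) (B A : {set V}) (v : V) :
  deg_in e A v = (deg_in e (A :&: B) v + deg_in e (A :\: B) v)%N.
Proof. by rewrite /deg_in !setIdE setIAC setIDAC cardsID. Qed.

Lemma deg_in_le_card (V : finType) (e : rel V) (A : {set V}) (v : V) :
  (deg_in e A v <= #|A|)%N.
Proof. by rewrite /deg_in setIdE subset_leq_card // subsetIl. Qed.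

Lemma deg_in_lt_card (V : finType) (e : rel V) (A : {set V}) (v : V) :
  irreflexive e -> v \in A -> (deg_in e A v < #|A|)%N.
Proof.
move=> e_irr vA; apply: proper_card; apply/properP; split.
  by rewrite setIdE subsetIl.
by exists v; rewrite // inE e_irr andbF.
Qed.

(** The neighbours that a remaining vertex has in [X], at most [#|X|] of them,
    are counted inside before the deletion and outside after it: this is
    where the factor 2 comes from. *)
Lemma defensive_allianceD (V : finType) (e : rel V) (k : int)
    (S X : {set V}) :
  defensive_alliance e k S -> X \subset S -> S :\: X != set0 ->
  defensive_alliance e (k - 2 * #|X|%:Z) (S :\: X).
Proof.
case/andP=> _ /forall_inP aS XS SX_n0; rewrite /defensive_alliance SX_n0 /=.
apply/forall_inP=> v; rewrite inE => /andP[_ /aS aSv].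
have degS : deg_in e S v = (deg_in e X v + deg_in e (S :\: X) v)%N.
  by rewrite (deg_inID _ _ X) (setIidPr XS).
have degC : deg_in e (~: (S :\: X)) v = (deg_in e X v + deg_in e (~: S) v)%N.
  rewrite (deg_inID _ _ X) setCD setUC (setIidPr (subsetUl X (~: S))).
  by rewrite setDUl setDv set0U (setDidPl _) // disjoints_subset setCS.
have := deg_in_le_card _ e X v.
lia.
Qed.

(** A vertex [v] of [S] has at least [(deg v + k) / 2] neighbours in [S], and
    it is not one of them. *)
Lemma min_degree_alliance_lt (V : finType) (e : rel V) (k : int)
    (S : {set V}) :
  irreflexive e -> defensive_alliance e k S ->
  k + (min_degree e)%:Z < 2 * #|S|%:Z.
Proof.
move=> e_irr /andP[/set0Pn[v vS] /forall_inP/(_ v vS) aSv].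
have deg_lt := deg_in_lt_card _ _ _ _ e_irr vS.
have := min_degree_le e v.
rewrite /degree (deg_inID _ _ S) setTI setTD.
lia.
Qed.

Theorem theorem3 (V : finType) (e : rel V) (e_sym : symmetric e)
    (e_irr : irreflexive e) (V_gt0 : (0 < #|V|)%N) (k r : int)
    (k_ge : - (min_degree e)%:Z <= k) (k_le : k <= (max_degree e)%:Z)
    (r_ge0 : 0 <= r)
    (r_le : r%:Q <= (k + (min_degree e)%:Z)%:Q / 2)
    (k_ex : exists S : {set V}, defensive_alliance e k S) :
  (alliance_number e (k - 2 * r))%:Z + r <= (alliance_number e k)%:Z.
Proof.
have {}r_le : 2 * r <= k + (min_degree e)%:Z.
  rewrite -(ler_int rat) intrM; lra.
have [S aS <-] := alliance_number_attained k_ex.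
have S_gt := min_degree_alliance_lt _ _ _ _ e_irr aS.
case: r r_ge0 r_le => // r _ r_le.
have r_lt : (r < #|S|)%N by lia.
have /card_geqP[s [s_uniq s_size sS]] := ltnW r_lt.
pose X := [set x in s].
have cardX : #|X| = r by rewrite cardsE (card_uniqP s_uniq).
have XS : X \subset S by apply/subsetP=> x; rewrite inE => /sS.
have cardD : #|S :\: X| = (#|S| - r)%N by rewrite cardsD (setIidPr XS) cardX.
have D_n0 : S :\: X != set0 by rewrite -card_gt0 cardD subn_gt0.
have := alliance_number_le (defensive_allianceD _ _ _ _ _ aS XS D_n0).
rewrite cardX cardD.
lia.
Qed.
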